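(* Let $G_p$ and $G_c$ be IF-OFP systems with passivity indices $(\nu_p,\rho_p)$ and $(\nu_c,\rho_c)$ respectively, interconnected in the plant-side event-triggered feedback loop described in the context, where the triggering instants $t_k$ are determined by the condition $\|e_p(t)\|_2^2>\delta\|y_p(t)\|_2^2$ with $\delta\in(0,1]$, and let $w_2=0$. Let $$\beta(\nu_c)=\begin{cases}\rho_p-\nu_c-\delta(1+\nu_c)&\text{if }\nu_c>0,\\ \rho_p-\delta&\text{if }\nu_c=0,\\ \rho_p+2\nu_c-\delta(1-3\nu_c)&\text{if }\nu_c<0.\end{cases}$$ If $\beta(\nu_c)\ge 0$, $\nu_p>0$ and $\rho_c>\tfrac14$, then the networked control system is passive from $w_1$ to $y_p$, meaning $$\dot V(t)\le w_1^T(t)y_p(t)$$ for a storage function $V$ of the interconnection.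
   Context: Systems: a system $G$ has the form $\dot x=f(x,u)$, $y=h(x,u)$ with state $x\in X\subset\mathbb{R}^n$ and $u(t),y(t)\in\mathbb{R}^m$. A storage function is a nonnegative function $V$ of the state; it is taken differentiable, and $\dot V(t)$ is the time derivative along solutions. $G$ is IF-OFP (input feed-forward output feedback passive) with input passivity index $\nu\in\mathbb{R}$ and output passivity index $\rho\in\mathbb{R}$ (of either sign) if there is a storage function $V$ with $\dot V\le u^Ty-\rho y^Ty-\nu u^Tu$ for all $t$ along all solutions. Plant-side event-triggered loop: $G_p$ (plant, state $x_p$, input $u_p$, output $y_p$) has indices $(\nu_p,\rho_p)$, and $G_c$ (controller, state $x_c$, input $u_c$, output $y_c$) has indices $(\nu_c,\rho_c)$; all inputs and outputs are $\mathbb{R}^m$-valued. External signals $w_1,w_2$ are $\mathbb{R}^m$-valued. At event instants $t_k$ the plant output is sampled and sent to the controller, and is held constant until the next event. For $t\in[t_k,t_{k+1})$: $u_p(t)=w_1(t)-y_c(t)$, $u_c(t)=w_2(t)+y_p(t_k)$, $e_p(t)=y_p(t)-y_p(t_k)$ (so $u_c=w_2+y_p-e_p$). A new event is triggered as soon as $\|e_p(t)\|_2^2>\delta\|y_p(t)\|_2^2$ (Euclidean norm of the vectors at time $t$), so that $e_p^T(t)e_p(t)\le\delta\, y_p^T(t)y_p(t)$ holds at all times. A storage function of the interconnection is a nonnegative function $V$ of $(x_p,x_c)$; inequalities on $\dot V$ are required along all solutions for all $t$ in the intervals $[t_k,t_{k+1})$. *)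

(* Defs.v *)
From HB Require Import structures.
From mathcomp Require Import all_boot all_order all_algebra.
From mathcomp Require Import all_classical all_reals all_analysis.

Set Implicit Arguments.
Unset Strict Implicit.
Unset Printing Implicit Defensive.

Import Order.TTheory GRing.Theory Num.Theory.
Import numFieldNormedType.Exports.

Local Open Scope classical_set_scope.
Local Open Scope ring_scope.

Definition dot (R : realType) (m : nat) (u v : 'cV[R]_m) : R :=
  (u^T *m v) ord0 ord0.

(* The library norm on matrices is the sup norm, hence a separate definition. *)
Definition enorm (R : realType) (m : nat) (v : 'cV[R]_m) : R :=
  Num.sqrt (dot v v).

(* The time interval [a, b[ of real numbers; b may be infinite. *)
Definition span_co (R : realType) (a b : \bar R) : set R :=
  [set s | (a <= s%:E)%E /\ (s%:E < b)%E].

(* Derivative at t of a signal that is only meaningful on I: the limit is taken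
   over s in I, s != t, so it is the right derivative at the left end of
   [a, b[ and the usual two-sided derivative at the other points. *)
Definition diff_quotient (R : realType) (E : normedModType R)
    (g : R -> E) (t s : R) : E := (s - t)^-1 *: (g s - g t).

Definition has_deriv_in (R : realType) (E : normedModType R) (I : set R)
    (g : R -> E) (t : R) (d : E) : Prop :=
  diff_quotient g t s @[s --> within I t^'] --> d.

Definition deriv_in (R : realType) (I : set R) (g : R -> R) (t : R) : R :=
  lim (diff_quotient g t s @[s --> within I t^']).

(* dx/dt = dynamics x u, y = output x u, with x in state_space; the values of
   dynamics and output outside state_space are irrelevant. *)
Record system (R : realType) (n m : nat) := System {
  state_space : set 'cV[R]_n ;
  dynamics : 'cV[R]_n -> 'cV[R]_m -> 'cV[R]_n ;
  output : 'cV[R]_n -> 'cV[R]_m -> 'cV[R]_m }.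

Definition solution (R : realType) (n m : nat) (G : system R n m)
    (I : set R) (x : R -> 'cV[R]_n) (u y : R -> 'cV[R]_m) : Prop :=
  forall t, I t ->
    [/\ state_space G (x t),
        has_deriv_in I x t (dynamics G (x t) (u t)) &
        y t = output G (x t) (u t)].

(* V is total, but only its sign at points of X is constrained; differentiability
   is that of the ambient space, at every point of X. *)
Definition storage (R : realType) (E : normedModType R) (X : set E)
    (V : E -> R) : Prop :=
  forall x, X x -> 0 <= V x /\ differentiable V x.

(* One V serves all solutions, on all intervals [a, b[.  The limit in deriv_in
   exists because V is differentiable and x has a derivative. *)
Definition if_ofp (R : realType) (n m : nat) (G : system R n m)
    (nu rho : R) : Prop :=
  exists V : 'cV[R]_n -> R,
    storage (state_space G) V /\
    forall (a : R) (b : \bar R) (x : R -> 'cV[R]_n) (u y : R -> 'cV[R]_m),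
      let I := span_co a%:E b in
      solution G I x u y ->
      forall t, I t ->
        deriv_in I (V \o x) t <=
          dot (u t) (y t) - rho * dot (y t) (y t) - nu * dot (u t) (u t).

Record loop_signals (R : realType) (np nc m : nat) := LoopSignals {
  xp : R -> 'cV[R]_np ; up : R -> 'cV[R]_m ; yp : R -> 'cV[R]_m ;
  xc : R -> 'cV[R]_nc ; uc : R -> 'cV[R]_m ; yc : R -> 'cV[R]_m }.

(* The feedback loop on I while the controller is fed the held sample yhat. *)
Definition held_loop (R : realType) (np nc m : nat)
    (Gp : system R np m) (Gc : system R nc m) (w1 w2 : R -> 'cV[R]_m)
    (I : set R) (yhat : 'cV[R]_m) (F : loop_signals R np nc m) : Prop :=
  [/\ solution Gp I (xp F) (up F) (yp F),
      solution Gc I (xc F) (uc F) (yc F) &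
      forall s, I s -> up F s = w1 s - yc F s /\ uc F s = w2 s + yhat].

Definition output_error (R : realType) (np nc m : nat)
    (F : loop_signals R np nc m) (tk s : R) : 'cV[R]_m := yp F s - yp F tk.

(* A run of the event-triggered loop.  F k is the flow started at the event
   instant t k with the sample yp (t k) held; it is defined on [t k, b k[ (b k
   is a horizon up to which this flow exists, possibly +oo).  The next event
   instant is the infimum of the times at which this flow violates the
   triggering bound, so F k describes the loop on [t k, t k.+1[; its values from
   t k.+1 on only say what the flow without the new event would be, which is
   needed to express that the event occurs as soon as the bound is violated.
   The states are continuous across events.  If the bound is never violated,
   t k.+1 = +oo (infimum of the empty set), and so are all later instants. *)
Record event_run (R : realType) (np nc m : nat)
    (Gp : system R np m) (Gc : system R nc m) (delta : R)
    (w1 w2 : R -> 'cV[R]_m) (t b : nat -> \bar R)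
    (F : nat -> loop_signals R np nc m) : Prop := EventRun {
  run_start : t 0%N \is a fin_num ;
  run_flow : forall k, t k \is a fin_num ->
    (t k < b k)%E /\
    held_loop Gp Gc w1 w2 (span_co (t k) (b k)) (yp (F k) (fine (t k))) (F k) ;
  run_trigger : forall k,
    t k.+1 = ereal_inf [set s%:E | s in
      [set s | span_co (t k) (b k) s /\
         enorm (output_error (F k) (fine (t k)) s) ^+ 2 >
           delta * enorm (yp (F k) s) ^+ 2]] ;
  run_resume : forall k, t k.+1 \is a fin_num ->
    xp (F k.+1) (fine (t k.+1)) = xp (F k) (fine (t k.+1)) /\
    xc (F k.+1) (fine (t k.+1)) = xc (F k) (fine (t k.+1)) }.

(* The inequality is required on [t k, t k.+1[, cut at b k when the last flow
   exists on a bounded interval only. *)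
Definition loop_passive (R : realType) (np nc m : nat)
    (Gp : system R np m) (Gc : system R nc m) (delta : R)
    (w2 : R -> 'cV[R]_m) : Prop :=
  exists V : 'cV[R]_np * 'cV[R]_nc -> R,
    storage (state_space Gp `*` state_space Gc) V /\
    forall (w1 : R -> 'cV[R]_m) (t b : nat -> \bar R)
      (F : nat -> loop_signals R np nc m),
      event_run Gp Gc delta w1 w2 t b F ->
      forall (k : nat) (s : R),
        let I := span_co (t k) (Order.min (t k.+1) (b k)) in
        I s ->
        deriv_in I (fun r => V (xp (F k) r, xc (F k) r)) s <=
          dot (w1 s) (yp (F k) s).

Definition beta (R : realType) (rhop delta nuc : R) : R :=
  if 0 < nuc then rhop - nuc - delta * (1 + nuc)
  else if nuc == 0 then rhop - delta
  else rhop + 2 * nuc - delta * (1 - 3 * nuc).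

(* Main.v *)
Require Import Defs.
From mathcomp Require Import all_boot all_order all_algebra.
From mathcomp Require Import all_classical all_reals all_analysis.
From mathcomp Require Import lra.

(** The sum V = Vp + Vc of the two storage functions is a storage function of
the loop.  Adding the two dissipation inequalities along a flow, with
[up = w1 - yc] and [uc = yp - e], the exchanged power [yp . yc] cancels and

<<
  V' <= w1.yp - e.yc - rhop |yp|^2 - rhoc |yc|^2 - nup |up|^2 - nuc |yp - e|^2.
>>

The only terms of indefinite sign are [- e.yc] and, when [nuc < 0], the last
one.  Young's inequality bounds the first by [|e|^2 + |yc|^2 / 4], whose second
summand is absorbed by [rhoc |yc|^2] because [1 / 4 < rhoc], and the second by
[- 2 nuc (|yp|^2 + |e|^2)].  The triggering rule gives [|e|^2 <= delta |yp|^2],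
so what remains is a multiple of [|yp|^2], whose coefficient is nonpositive as
soon as [beta] is nonnegative ([supply_rate_le]).

Two points concern the time dependence.  The error bound holds before the next
event because that event is the infimum of the violation times
([output_error_le]).  And [deriv_in] is a bare limit, so that its additivity
[deriv_inD] needs the derivatives of both [Vp \o xp] and [Vc \o xc] to exist,
by the chain rule [has_deriv_in_comp], and limits along the interval to be
unique, by [span_co_dnbhs_proper]. *)

Set Implicit Arguments.
Unset Strict Implicit.
Unset Printing Implicit Defensive.

Import Order.TTheory GRing.Theory Num.Theory.
Import numFieldNormedType.Exports.

Local Open Scope classical_set_scope.
Local Open Scope ring_scope.

(** * The inner product *)

Lemma dotC (R : realType) (m : nat) (u v : 'cV[R]_m) : dot u v = dot v u.
Proof. by rewrite /dot !mxE; apply: eq_bigr => i _; rewrite !mxE mulrC. Qed.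

Lemma dotDl (R : realType) (m : nat) (u v w : 'cV[R]_m) :
  dot (u + v) w = dot u w + dot v w.
Proof. by rewrite /dot linearD mulmxDl mxE. Qed.

Lemma dotZl (R : realType) (m : nat) (a : R) (u w : 'cV[R]_m) :
  dot (a *: u) w = a * dot u w.
Proof. by rewrite /dot linearZ -scalemxAl mxE. Qed.

Lemma dotNl (R : realType) (m : nat) (u w : 'cV[R]_m) :
  dot (- u) w = - dot u w.
Proof. by rewrite -scaleN1r dotZl mulN1r. Qed.

Lemma dot_ge0 (R : realType) (m : nat) (u : 'cV[R]_m) : 0 <= dot u u.
Proof. by rewrite /dot mxE sumr_ge0// => i _; rewrite mxE -expr2 sqr_ge0. Qed.

Lemma dotDr (R : realType) (m : nat) (u v w : 'cV[R]_m) :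
  dot u (v + w) = dot u v + dot u w.
Proof. by rewrite !(dotC u) dotDl. Qed.

Lemma dotZr (R : realType) (m : nat) (a : R) (u w : 'cV[R]_m) :
  dot u (a *: w) = a * dot u w.
Proof. by rewrite !(dotC u) dotZl. Qed.

Lemma dotNr (R : realType) (m : nat) (u w : 'cV[R]_m) :
  dot u (- w) = - dot u w.
Proof. by rewrite !(dotC u) dotNl. Qed.

Definition dotE := (dotDl, dotNl, dotZl, dotDr, dotNr, dotZr).

Lemma enorm_sqr (R : realType) (m : nat) (u : 'cV[R]_m) :
  enorm u ^+ 2 = dot u u.
Proof. by rewrite sqr_sqrtr ?dot_ge0. Qed.

(** * The dissipation inequality *)

(** The two supply rates add up to at most [w . yp]; [beta] is large enough
to absorb the sampling error [e] in each of the three sign regimes of [nuc]. *)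
Lemma supply_rate_le (R : realType) (m : nat) (w yp yc e : 'cV[R]_m)
    (nup rhop nuc rhoc delta : R) :
  0 < delta -> 0 <= beta rhop delta nuc -> 0 < nup -> 1 / 4 < rhoc ->
  dot e e <= delta * dot yp yp ->
  dot (w - yc) yp - rhop * dot yp yp - nup * dot (w - yc) (w - yc) +
  (dot (yp - e) yc - rhoc * dot yc yc - nuc * dot (yp - e) (yp - e)) <=
  dot w yp.
Proof.
move=> d0 hb nup0 rc ee.
have up0 : 0 <= nup * dot (w - yc) (w - yc) by rewrite mulr_ge0 ?dot_ge0// ltW.
have yc0 : 0 <= (rhoc - 1 / 4) * dot yc yc
  by rewrite mulr_ge0 ?dot_ge0// subr_ge0 ltW.
have yp0 := dot_ge0 yp.
(* Young's inequality: the square of e + yc / 2 is nonnegative. *)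
have cross : - dot e yc <= dot e e + 1 / 4 * dot yc yc.
  have := dot_ge0 (e + (1 / 2) *: yc).
  rewrite !dotE (dotC yc e); lra.
suff core : (dot e e - rhop * dot yp yp) - nuc * dot (yp - e) (yp - e) <= 0.
  move: core; rewrite [dot (w - yc) yp]dotDl [dot (yp - e) yc]dotDl !dotNl.
  rewrite (dotC yc yp); lra.
move: hb; rewrite /beta; case: ltgtP => [nuc0|nuc0|<-] hb.
- have ? : 0 <= nuc * dot (yp - e) (yp - e) by rewrite mulr_ge0 ?dot_ge0// ltW.
  have ? : 0 <= (rhop - delta) * dot yp yp by rewrite mulr_ge0 //; nra.
  lra.
- (* Here - nuc > 0, so |yp - e|^2 is to be bounded above: by the parallelogram
     law its distance to 2 |yp|^2 + 2 |e|^2 is |yp + e|^2. *)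
  have parallelogram : dot (yp - e) (yp - e) <= 2 * dot yp yp + 2 * dot e e.
    have := dot_ge0 (yp + e).
    rewrite !dotE (dotC e yp); lra.
  have ? : - nuc * dot (yp - e) (yp - e) <=
      - nuc * (2 * dot yp yp + 2 * (delta * dot yp yp)).
    apply: ler_wpM2l; lra.
  have ? : 0 <= (rhop + 2 * nuc - delta * (1 - 2 * nuc)) * dot yp yp.
    by rewrite mulr_ge0 //; nra.
  lra.
- have ? : 0 <= (rhop - delta) * dot yp yp by rewrite mulr_ge0.
  lra.
Qed.

(** * Derivatives on half-open intervals *)

(** A point of [a, b[ is a limit of points of [a, b[ to its right, even when it
is the left end; limits in [deriv_in] are therefore unique. *)
Lemma span_co_dnbhs_proper (R : realType) (a b : \bar R) (t : R) :
  span_co a b t -> ProperFilter (within (span_co a b) t^').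
Proof.
move=> [at_ tb]; apply: Build_ProperFilter_ex => P; rewrite /within /= => nP.
have rP : \forall s \near t^'+, span_co a b s -> P s.
  rewrite /at_right near_withinE; move: nP; rewrite /dnbhs near_withinE.
  by apply: filterS => s h ts; apply: h; rewrite gt_eqF.
have rb : \forall s \near t^'+, (s%:E < b)%E.
  case: b tb {nP rP} => [r tr|_|//]; last first.
    by apply: nearW => s; rewrite ltry.
  by near=> s; rewrite lte_fin; near: s; exact: nbhs_right_lt.
have rt : \forall s \near t^'+, t < s by exact: nbhs_right_gt.
near t^'+ => s; exists s.
have ts : t < s by near: s.
apply: (near rP s) => //; split; last by near: s.
by apply: le_trans at_ _; rewrite lee_fin ltW.
Unshelve. all: by end_near. Qed.

(** The chain rule for derivatives relative to [I].  The difference quotient of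
[V \o x] is the differential of [V] applied to that of [x], which converges by
continuity, plus the remainder of [V] divided by [s - t]; the remainder is
[o(x s - x t)] and the difference quotient of [x] is bounded, so this last term
vanishes in the limit. *)
Lemma has_deriv_in_comp (R : realType) (E : normedModType R) (I : set R)
    (x : R -> E) (t : R) (d : E) (V : E -> R) :
  ProperFilter (within I t^') ->
  has_deriv_in I x t d -> differentiable V (x t) ->
  has_deriv_in I (V \o x) t ('d V (x t) d).
Proof.
move=> FF xd dV; rewrite /has_deriv_in.
set F := within I t^' in FF xd *.
have tF : (s - t) @[s --> F] --> (0 : R).
  rewrite -[X in _ --> X](subrr t); apply: cvgB; last exact: cvg_cst.
  move=> A tA; change (nbhs t (fun s => s != t -> I s -> A s)).
  by apply: filterS tA => s As _ _.
have nt : \forall s \near F, s != t.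
  change (nbhs t (fun s => s != t -> I s -> s != t)).
  by apply: (@nearW _ (nbhs t)) => s st _.
have xF : (x s - x t) @[s --> F] --> (0 : E).
  rewrite -(scale0r d).
  apply: cvg_trans (cvgZ tF xd); apply: near_eq_cvg.
  near=> s; rewrite /diff_quotient scalerA divff ?scale1r// subr_eq0.
  by near: s.
have dVc : continuous ('d V (x t)) by exact: diff_continuous.
have main : 'd V (x t) (diff_quotient x t s) @[s --> F] --> 'd V (x t) d.
  exact: (cvg_comp _ _ xd (dVc d)).
pose r s := diff_quotient (V \o x) t s - 'd V (x t) (diff_quotient x t s).
suff r0 : r s @[s --> F] --> (0 : R).
  rewrite -['d V _ _]add0r; apply: cvg_trans (cvgD r0 main).
  by apply: near_eq_cvg; near=> s; rewrite /r subrK.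
apply/cvgr0Pnorm_le => e e0.
have k0 : 0 < `|d| + 1 by rewrite ltr_wpDl.
(* The difference quotient of x is eventually bounded by `|d| + 1. *)
have ek0 : 0 < e / (`|d| + 1) by rewrite divr_gt0.
have rem0 : \forall h \near (0 : E),
    `|V (h + x t) - V (x t) - 'd V (x t) h| <= e / (`|d| + 1) * `|h|.
  have /eqaddoP/(_ _ ek0) := diff_locally dV.
  by apply: filterS => h /=; rewrite opprD addrA.
have dq_bounded : \forall s \near F, `|diff_quotient x t s| <= `|d| + 1.
  near=> s; rewrite -[diff_quotient x t s](subrK d) addrC.
  rewrite (le_trans (ler_normD _ _))// lerD2l distrC; near: s.
  by move/cvgrPdist_le : xd; exact.
have remF := xF _ rem0.
near=> s.
have st : s - t != 0 by rewrite subr_eq0; near: s.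
have -> : r s = (s - t)^-1 *
    (V (x s - x t + x t) - V (x t) - 'd V (x t) (x s - x t)).
  by rewrite /r /diff_quotient /= linearZ subrK -scalerBr.
have rem : `|V (x s - x t + x t) - V (x t) - 'd V (x t) (x s - x t)| <=
    e / (`|d| + 1) * `|x s - x t| by near: s.
rewrite normrM (le_trans (ler_wpM2l _ rem))// mulrCA -normrZ.
rewrite -ler_pdivlMl ?divr_gt0// invf_div divfK ?gt_eqF//.
by near: s.
Unshelve. all: by end_near. Qed.

Lemma deriv_inD (R : realType) (I : set R) (f g : R -> R) (t df dg : R) :
  ProperFilter (within I t^') ->
  has_deriv_in I f t df -> has_deriv_in I g t dg ->
  deriv_in I (f \+ g) t = deriv_in I f t + deriv_in I g t.
Proof.
move=> FF fd gd.
rewrite /deriv_in (cvg_lim _ fd)// (cvg_lim _ gd)//.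
apply: cvg_lim => //; apply: cvg_trans (cvgD fd gd); apply: near_eq_cvg.
by apply: nearW => s; rewrite /diff_quotient !fctE -scalerDr opprD addrACA.
Qed.

(** Passivity is applied to the flow cut at the next event, which is a solution
on that shorter interval; cutting leaves the derivatives unchanged because
limits pass to smaller domains. *)
Lemma solution_sub (R : realType) (n m : nat) (G : system R n m)
    (I J : set R) (x : R -> 'cV[R]_n) (u y : R -> 'cV[R]_m) :
  J `<=` I -> solution G I x u y -> solution G J x u y.
Proof.
move=> JI sol t /JI/sol[Xx xd yE]; split => //.
rewrite /has_deriv_in; apply: (cvg_trans _ xd); apply: cvg_app.
exact: within_subset.
Qed.

(** * The event-triggered run *)

Lemma event_time_gtNy (R : realType) (np nc m : nat)
    (Gp : system R np m) (Gc : system R nc m) (delta : R)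
    (w1 w2 : R -> 'cV[R]_m) (t b : nat -> \bar R)
    (F : nat -> loop_signals R np nc m) (k : nat) :
  event_run Gp Gc delta w1 w2 t b F -> (-oo < t k)%E.
Proof.
move=> run; elim: k => [|k IHk].
  by have := run_start run; rewrite fin_numE ltNye => /andP[].
apply: (lt_le_trans IHk); rewrite (run_trigger run).
by apply: le_ereal_inf_tmp => _ [s [[ts _] _] <-].
Qed.

(** A violation at [s] would put the infimum of the violation times, i.e. the
next event, at or before [s]. *)
Lemma output_error_le (R : realType) (np nc m : nat)
    (Gp : system R np m) (Gc : system R nc m) (delta : R)
    (w1 w2 : R -> 'cV[R]_m) (t b : nat -> \bar R)
    (F : nat -> loop_signals R np nc m) (k : nat) (s : R) :
  event_run Gp Gc delta w1 w2 t b F ->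
  span_co (t k) (Order.min (t k.+1) (b k)) s ->
  dot (output_error (F k) (fine (t k)) s) (output_error (F k) (fine (t k)) s) <=
  delta * dot (yp (F k) s) (yp (F k) s).
Proof.
move=> run [ts]; rewrite lt_min => /andP[st sb]; rewrite leNgt; apply/negP => viol.
move: st; rewrite ltNge (run_trigger run) => /negP; apply.
apply: ge_ereal_inf; exists s%:E => //; exists s => //.
by split; rewrite ?enorm_sqr.
Qed.

(** * Passivity of the loop *)

Lemma storage_add (R : realType) (E1 E2 : normedModType R) (X1 : set E1)
    (X2 : set E2) (V1 : E1 -> R) (V2 : E2 -> R) :
  storage X1 V1 -> storage X2 V2 ->
  storage (X1 `*` X2) (fun x => V1 x.1 + V2 x.2).
Proof.
move=> S1 S2 x [/S1[V1x dV1] /S2[V2x dV2]]; split; first exact: addr_ge0.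
apply: differentiableD.
  apply: (@differentiable_comp _ _ _ _ fst V1) => //.
  by apply: linear_differentiable => y; exact: cvg_fst.
apply: (@differentiable_comp _ _ _ _ snd V2) => //.
by apply: linear_differentiable => y; exact: cvg_snd.
Qed.

Theorem theorem4 (R : realType) (np nc m : nat)
  (Gp : system R np m) (Gc : system R nc m)
  (nup rhop nuc rhoc delta : R) (w2 : R -> 'cV[R]_m)
  (Gp_ifofp : if_ofp Gp nup rhop)
  (Gc_ifofp : if_ofp Gc nuc rhoc)
  (delta_gt0 : 0 < delta) (delta_le1 : delta <= 1)
  (w2_eq0 : forall s, w2 s = 0)
  (beta_ge0 : 0 <= beta rhop delta nuc)
  (nup_gt0 : 0 < nup)
  (rhoc_gt : 1 / 4 < rhoc) :
  loop_passive Gp Gc delta w2.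
Proof.
have [Vp [Sp Dp]] := Gp_ifofp; have [Vc [Sc Dc]] := Gc_ifofp.
exists (fun x => Vp x.1 + Vc x.2); split; first exact: storage_add.
move=> w1 t b F run k s I Is.
(* The instant t k is +oo after the last event, but then I is empty. *)
have tk : t k \is a fin_num.
  rewrite fin_numE -ltNye (event_time_gtNy k run) -ltey.
  by case: Is => /le_lt_trans -> //; rewrite ltry.
have tkE : t k = (fine (t k))%:E by rewrite fineK.
have [_ [solp solc wiring]] := run_flow run tk.
have sub : I `<=` span_co (t k) (b k).
  by move=> r [tr]; rewrite lt_min => /andP[].
have [upE ucE] := wiring s (sub s Is).
have FF := span_co_dnbhs_proper Is.
have {}solp := solution_sub sub solp.
have {}solc := solution_sub sub solc.
have [Xp xpd _] := solp s Is.
have [Xc xcd _] := solc s Is.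
rewrite (deriv_inD FF (has_deriv_in_comp FF xpd (Sp _ Xp).2)
  (has_deriv_in_comp FF xcd (Sc _ Xc).2)).
have := output_error_le run Is; set e := output_error _ _ _ => ee.
have ucE' : uc (F k) s = yp (F k) s - e.
  by rewrite ucE w2_eq0 add0r /e /output_error opprB addrC subrK.
(* if_ofp quantifies over intervals with a real left end. *)
move: solp solc Is; rewrite /I tkE => solp solc Is.
have := lerD (Dp _ _ _ _ _ solp s Is) (Dc _ _ _ _ _ solc s Is).
rewrite upE ucE' => /le_trans; apply.
exact: (supply_rate_le _ _ delta_gt0 beta_ge0 nup_gt0 rhoc_gt ee).
Qed.
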